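(* Let $n\ge 1$ and let $f\in C^1(\mathbb R^n)$ be a real-valued function that is not affine. Suppose that there is $p_\infty\in\mathbb R^n$ such that $\nabla f(x)\to p_\infty$ as $|x|\to\infty$. Let $G_f=\{\nabla f(x):x\in\mathbb R^n\}$. Then $$\overline{G_f}=\overline{\operatorname{int} G_f}.$$
   Context: The interior and closure of subsets of $\mathbb R^n$ are taken in the Euclidean topology, and $|\cdot|$ is the Euclidean norm. *)

(* Defs.v *)
From mathcomp Require Import all_boot all_order all_algebra.
From mathcomp Require Import all_classical all_reals all_analysis.

Set Implicit Arguments.
Unset Strict Implicit.
Unset Printing Implicit Defensive.

Import Order.TTheory GRing.Theory Num.Theory.
Import numFieldNormedType.Exports.

Local Open Scope classical_set_scope.
Local Open Scope ring_scope.

(* R^n is 'rV[R]_n. Its library norm is the sup norm, so the Euclidean norm is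
   defined here; the library topology on 'rV[R]_n (used by nbhs, continuous,
   closure, interior and differentiable) is the product topology, which is the
   Euclidean one. *)
Definition dot (R : realType) (n : nat) (x y : 'rV[R]_n) : R :=
  \sum_(i < n) x 0 i * y 0 i.

Definition enorm (R : realType) (n : nat) (x : 'rV[R]_n) : R :=
  Num.sqrt (dot x x).

Definition grad (R : realType) (n : nat) (f : 'rV[R]_n -> R) (x : 'rV[R]_n) :
    'rV[R]_n :=
  \row_(i < n) 'D_(delta_mx 0 i) f x.

(* Differentiability is required separately: 'D_v f x is a total function with
   an unspecified value where the derivative does not exist. *)
Definition is_C1 (R : realType) (n : nat) (f : 'rV[R]_n -> R) : Prop :=
  (forall x, differentiable f x) /\ continuous (grad f).

Definition is_affine (R : realType) (n : nat) (f : 'rV[R]_n -> R) : Prop :=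
  exists (a : 'rV[R]_n) (b : R), forall x, f x = dot a x + b.

(* The filter "|x| -> oo" on R^n. *)
Definition enorm_pinfty (R : realType) (n : nat) : set_system 'rV[R]_n :=
  [set A | exists M : R, forall x, M < enorm x -> A x].
Arguments enorm_pinfty : clear implicits.

#[global] Instance enorm_pinfty_filter (R : realType) (n : nat) :
  Filter (enorm_pinfty R n).
Proof.
split; first by exists 0.
- move=> A B [M MA] [N NB]; exists (Num.max M N) => x.
  by rewrite gt_max => /andP[Mx Nx]; split; [exact: MA | exact: NB].
- by move=> A B AB [M MA]; exists M => x Mx; apply/AB/MA.
Qed.

(* Main.v *)
Require Import Defs.
From mathcomp Require Import all_boot all_order all_algebra.
From mathcomp Require Import all_classical all_reals all_analysis.
From mathcomp Require Import ring lra.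

Set Implicit Arguments.
Unset Strict Implicit.
Unset Printing Implicit Defensive.

(** Write f_q(x) = f(x) - q . x for the function f tilted by the slope q; its
    gradient is grad f - q. Fix a value p0 = grad f(x0) different from the limit p
    of the gradient at infinity and suppose, for contradiction, that it is not in
    the closure of the interior of the gradient range G. Then the slopes q outside G
    are dense near p0, and for each of them f_q has no critical points, not even at
    infinity. Hence every sublevel set of f_q is a deformation retract of every
    larger one.

    This is incompatible with the local shape of f at x0. Take x0 = 0, p0 = 0 and
    f(0) = 0, so that f(x) = o(|x|). For y in the cube [-1, 1]^n consider the slope
    k y, and the map y |-> d y from the cube to R^n, with k and d small. Over the
    boundary of the cube, f_(k y)(d y) is bounded above by a negative number. If
    every slope k y were omitted by the gradient, in a uniform way, one could push
    the points d y down by gradient descent for f_(k y), keeping the boundary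
    values, until f_(k y)(h(y)) < 0 for all y. The resulting map h agrees with y |->
    d y on the boundary of the cube, so by the Poincare-Miranda theorem h(y) = 0 for
    some y, and then f_(k y)(h(y)) = f(0) = 0, a contradiction.

    The omitted slopes are only dense, so the descent is done piecewise: cover the
    cube by small cells around lattice points z, choose an omitted slope near each k
    z, and apply the corresponding deformations one after another, cut off outside
    the cell of z ([no_dense_regular_slopes]). Exchanging the slope for k y costs a
    little each time, but over a given y only a number of steps bounded in terms of
    n is active. These costs are small compared with the gain once the cells are
    small, provided that the points stay in a ball chosen beforehand. They do: the
    gradient of f_q is bounded below near infinity uniformly in q, so far away the
    displacement is controlled by the drop of f_q, however badly the deformation
    behaves elsewhere ([pushdown_exists]). Discrete descent steps replace the
    gradient flow, which need not be well defined, the gradient being merely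
    continuous.

    The Poincare-Miranda theorem is derived from a cubical version of Sperner's
    lemma ([odd_rainbow]), proved with mod 2 cochains and the prism operator.

    Finally, if grad f(x0) = p then grad f(x0) is a limit of gradient values
    different from p, because f is not affine and the gradient range is connected. *)

Import Order.TTheory GRing.Theory Num.Theory.
Import numFieldNormedType.Exports.

(** * Sperner's lemma on a cubical grid *)

Section Sperner.
Local Open Scope nat_scope.

Local Notation "\xor_ ( i <- r ) F" := (\big[addb/false]_(i <- r) F)
  (at level 36, F at level 36, i, r at level 50).

Local Notation vertex := (seq nat).
Local Notation simplex := (seq (seq nat)).

Fixpoint faces (T : Type) (s : seq T) : seq (seq T) :=
  if s is v :: s' then s' :: map (cons v) (faces s') else [::].

(** The standard subdivision of the prism s * [k, k+1], the new coordinate being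
    put at the head of each vertex. *)
Fixpoint prism (k : nat) (s : simplex) : seq simplex :=
  if s is v :: s' then
    ((k :: v) :: map (cons k.+1) s) :: map (cons (k :: v)) (prism k s')
  else [::].

Definition coboundary (F : simplex -> bool) (s : simplex) : bool :=
  \xor_(t <- faces s) F t.

(** The prism operator acting on mod 2 cochains. *)
Definition prism_pull (k : nat) (F : simplex -> bool) (s : simplex) : bool :=
  \xor_(t <- prism k s) F t.

Lemma faces_map (T U : Type) (f : T -> U) s :
  faces (map f s) = map (map f) (faces s).
Proof.
elim: s => //= v s ->; congr cons; rewrite -!map_comp.
by apply: eq_map => t /=.
Qed.

Lemma coboundary_cons F v s :
  coboundary F (v :: s) = F s (+) coboundary (F \o cons v) s.
Proof. by rewrite /coboundary /= big_cons big_map. Qed.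

Lemma prism_pull_cons k F v s :
  prism_pull k F (v :: s) =
  F ((k :: v) :: map (cons k.+1) (v :: s)) (+) prism_pull k (F \o cons (k :: v)) s.
Proof. by rewrite /prism_pull /= big_cons big_map. Qed.

Lemma prism_pull_addb k F G s :
  prism_pull k (fun t => F t (+) G t) s = prism_pull k F s (+) prism_pull k G s.
Proof. exact: big_split. Qed.

Lemma coboundary_addb F G s :
  coboundary (fun t => F t (+) G t) s = coboundary F s (+) coboundary G s.
Proof. exact: big_split. Qed.

Lemma eq_coboundary F G s : F =1 G -> coboundary F s = coboundary G s.
Proof. by move=> FG; apply: eq_bigr. Qed.

Lemma eq_prism_pull k F G s : F =1 G -> prism_pull k F s = prism_pull k G s.
Proof. by move=> FG; apply: eq_bigr. Qed.

(** The prism operator is a chain homotopy between the top and the bottom of the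
    prism.  Cutting off the first vertex of the simplex turns the identity into
    the same identity for the cochain [F \o cons (k :: v)], and all remaining terms
    cancel in pairs. *)
Lemma prism_homotopy k F s :
  prism_pull k (coboundary F) s (+) coboundary (prism_pull k F) s =
  F (map (cons k.+1) s) (+) F (map (cons k) s).
Proof.
elim: s F => [|v s IHs] F.
  by rewrite /prism_pull /coboundary /= !big_nil !addbb.
rewrite prism_pull_cons !coboundary_cons /=.
rewrite (eq_prism_pull k s (coboundary_cons F (k :: v))) prism_pull_addb.
rewrite (eq_coboundary s (prism_pull_cons k F v)) coboundary_addb.
have := IHs (F \o cons (k :: v)) => /=.
have -> : coboundary (fun x : simplex => F [:: k :: v, k.+1 :: v & map (cons k.+1) x]) s
   = coboundary ((F \o cons (k :: v)) \o cons (k.+1 :: v)) (map (cons k.+1) s).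
  by rewrite /coboundary faces_map big_map.
rewrite -/(map (cons k.+1) s).
case: (prism_pull k F s); case: (prism_pull k _ s);
case: (coboundary (prism_pull _ _) s); case: (coboundary _ (map _ _));
by case: (F _); case: (F _); case: (F _).
Qed.

Section Grid.
Variable N : nat.

(** Iterating the prism construction triangulates the cube [0, N]^n.  The grid is
    kept as a list of simplices, so that integrating a mod 2 cochain over it is a
    big exclusive or. *)
Fixpoint grid (n : nat) : seq simplex :=
  if n is n'.+1 then flatten [seq flatten (map (prism k) (grid n')) | k <- iota 0 N]
  else [:: [:: [::]]].

Lemma sum_grid n F : \xor_(s <- grid n.+1) F s =
  \xor_(k <- iota 0 N) \xor_(s <- grid n) prism_pull k F s.
Proof.
by rewrite /= big_flatten big_map; apply: eq_bigr => k _; rewrite big_flatten big_map.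
Qed.

Definition on_grid n (s : simplex) := all (fun v => (size v == n) && all (leq^~ N) v) s.

Definition on_face n (i c : nat) (s : simplex) :=
  on_grid n s && all (fun v => nth 0 v i == c) s.

Lemma prismP (a : pred vertex) (k : nat) s t : t \in prism k s ->
  (forall v, v \in s -> a (k :: v) && a (k.+1 :: v)) -> all a t.
Proof.
elim: s t => //= v s IHs t; rewrite inE => /orP[/eqP->|/mapP[u uP ->]] sa /=.
  have /andP[-> ->] := sa v (mem_head _ _); rewrite /= all_map.
  by apply/allP => w ws /=; have /andP[] := sa w (mem_behead (s := v :: s) ws).
have /andP[-> _] := sa v (mem_head _ _).
by apply: IHs => // w ws; apply: sa; rewrite inE ws orbT.
Qed.

Lemma on_face_prism n i c k s t : (k < N)%N -> on_face n i c s -> t \in prism k s ->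
  on_face n.+1 i.+1 c t.
Proof.
move=> kN /andP[/allP gs /allP fs] ts; apply/andP; split.
  apply: (prismP ts) => v vs /=; have /= /andP[/eqP-> ->] := gs v vs.
  by rewrite !eqxx (ltnW kN) kN.
by apply: (prismP ts) => v vs /=; rewrite fs.
Qed.

Lemma on_grid_prism n k s t : (k < N)%N -> on_grid n s -> t \in prism k s ->
  on_grid n.+1 t.
Proof.
move=> kN /allP gs ts.
apply: (prismP ts) => v vs /=; have /= /andP[/eqP-> ->] := gs v vs.
by rewrite !eqxx (ltnW kN) kN.
Qed.

Lemma grid_on_grid n s : s \in grid n -> on_grid n s.
Proof.
elim: n s => [|n IHn] s /=; first by rewrite inE => /eqP->.
move=> /flattenP[l /mapP[k]]; rewrite mem_iota add0n => /andP[_ kN] -> {l}.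
move=> /flattenP[l /mapP[t tg ->] {l}] st.
exact: on_grid_prism kN (IHn _ tg) st.
Qed.

Lemma grid_cube n s : s \in grid n ->
  exists w, forall v, v \in s -> forall i, (i < n)%N ->
  nth 0 w i <= nth 0 v i <= (nth 0 w i).+1.
Proof.
elim: n s => [|n IHn] s /=; first by exists [::].
move=> /flattenP[l /mapP[k _ ->] {l}].
move=> /flattenP[l /mapP[t /IHn [w wt] ->] {l}] st.
exists (k :: w) => v vs i ilt.
suff /allP/(_ v vs) :
  all (fun v => nth 0 (k :: w) i <= nth 0 v i <= (nth 0 (k :: w) i).+1) s by [].
apply: (prismP st) => u us; case: i ilt => [_|i ilt] /=.
  by rewrite !leqnn leqnSn.
by rewrite wt.
Qed.

Lemma size_grid n s : s \in grid n -> size s = n.+1.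
Proof.
elim: n s => [|n IHn] s /=; first by rewrite inE => /eqP->.
move=> /flattenP[l /mapP[k _ ->] {l}].
move=> /flattenP[l /mapP[t /IHn tn ->] {l}]; rewrite -tn => {tn IHn}.
elim: t s => //= v t IHt s; rewrite inE => /orP[/eqP->|/mapP[u /IHt <- ->]] //=.
by rewrite size_map.
Qed.

Lemma addb_telescope (f : nat -> bool) m :
  \xor_(k <- iota 0 m) (f k.+1 (+) f k) = f m (+) f 0.
Proof.
elim: m => [|m IHm]; first by rewrite big_nil addbb.
rewrite -[in LHS]addn1 iotaD big_cat IHm big_seq1 add0n.
by case: (f m) (f m.+1) (f 0) => [] [] [].
Qed.

(** Integrated over all prisms [k, k+1], the homotopy terms telescope to the faces
    where the first coordinate is N or 0. *)
Lemma stokes_step n F : \xor_(s <- grid n.+1) coboundary F s =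
  (\xor_(k <- iota 0 N) \xor_(s <- grid n) coboundary (prism_pull k F) s) (+)
  ((\xor_(s <- grid n) F (map (cons N) s)) (+)
   (\xor_(s <- grid n) F (map (cons 0) s))).
Proof.
rewrite -(addb_telescope (fun k => \xor_(s <- grid n) F (map (cons k) s))).
rewrite -big_split /= sum_grid; apply: eq_bigr => k _.
rewrite -!big_split /=; apply: eq_bigr => s _.
by rewrite -prism_homotopy addbC -addbA addbb addbF.
Qed.

Lemma big_xor0 (T : eqType) (r : seq T) (F : T -> bool) :
  (forall x, x \in r -> F x = false) -> \xor_(x <- r) F x = false.
Proof. by move=> F0; rewrite big_seq big1. Qed.

(** Stokes' formula for a cochain that vanishes on the boundary of the cube.  In
    dimension 0 the only face is the empty simplex, whence the first hypothesis. *)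
Lemma stokes_closed n F : (n = 0 -> F [::] = false) ->
  (forall (i c : nat) s, i < n -> (c == 0) || (c == N) ->
    on_face n i c s -> F s = false) ->
  \xor_(s <- grid n) coboundary F s = false.
Proof.
elim: n F => [|n IHn] F F0 Fb.
  by rewrite big_seq1 /coboundary /= big_seq1 F0.
have head c s : (c == 0) || (c == N) -> s \in grid n -> F (map (cons c) s) = false.
  move=> cN sg; apply: (Fb 0 c) => //; rewrite /on_face /on_grid !all_map.
  apply/andP; split; apply/allP => v vs //=.
  have /allP/(_ v vs)/= /andP[/eqP-> ->] := grid_on_grid sg; rewrite ?eqxx.
  by case/orP: cN => /eqP->; rewrite ?eqxx ?leqnn.
rewrite stokes_step !(big_xor0 (r := grid n)) ?addbF; first last.
- by move=> s sg; apply: head; rewrite ?eqxx ?orbT.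
- by move=> s sg; apply: head.
apply: big_xor0 => k; rewrite mem_iota add0n => /andP[_ kN].
apply: IHn => [n0|i c s lin cN sf]; first by rewrite /prism_pull big_nil.
apply: big_xor0 => t ts; apply: (Fb i.+1 c) => //.
exact: on_face_prism sf ts.
Qed.

Lemma stokes_one_face n F :
  (forall s, on_face n.+1 0 0 s -> F s = false) ->
  (forall (i c : nat) s, 0 < i < n.+1 -> (c == 0) || (c == N) ->
    on_face n.+1 i c s -> F s = false) ->
  \xor_(s <- grid n.+1) coboundary F s = \xor_(s <- grid n) F (map (cons N) s).
Proof.
move=> F0 Fb; rewrite stokes_step [X in _ (+) (_ (+) X)]big_xor0 ?addbF; last first.
  move=> s sg; apply: F0; rewrite /on_face /on_grid !all_map.
  apply/andP; split; apply/allP => v vs //=.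
  by have /allP/(_ v vs)/= /andP[/eqP-> ->] := grid_on_grid sg; rewrite ?eqxx.
rewrite big_xor0 // => k; rewrite mem_iota add0n => /andP[_ kN].
apply: stokes_closed => [n0|i c s lin cN sf]; first by rewrite /prism_pull big_nil.
apply: big_xor0 => t ts; apply: (Fb i.+1 c) => //.
exact: on_face_prism sf ts.
Qed.

End Grid.

Definition rainbow (l : vertex -> nat) n (s : simplex) := perm_eq (map l s) (iota 0 n).

Lemma xor_faces (T : eqType) (r : seq T) (F : seq T -> bool) (G : T -> bool) :
  (forall y t, perm_eq (y :: t) r -> F t = G y) ->
  \xor_(t <- faces r) F t = \xor_(y <- r) G y.
Proof.
elim: r F G => [|v s IHs] F G FG; first by rewrite !big_nil.
rewrite /= !big_cons big_map (FG v s (perm_refl _)) (IHs _ G) // => y t yt.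
apply: FG; rewrite -[v :: s]cat1s -[_ :: _ :: _]/([:: y] ++ [:: v] ++ t).
by rewrite perm_catCA perm_cons.
Qed.

Lemma xor_count (T : eqType) (r : seq T) (x : T) :
  \xor_(y <- r) (y == x) = odd (count_mem x r).
Proof.
elim: r => [|y r IHr]; first by rewrite big_nil.
by rewrite big_cons IHr /= oddD; case: (y == x).
Qed.

Lemma perm_cons_inj (T : eqType) (x y : T) (s : seq T) :
  perm_eq (x :: s) (y :: s) -> x = y.
Proof.
move=> /permP/(_ (pred1 x)) /= /eqP; rewrite eqxx eqn_add2r.
by case: (eqVneq y x) => [->|].
Qed.

(** Sperner's parity argument: the faces that carry all labels below n arise by
    deleting an entry equal to x, where x is the label that completes 0, ..., n-1
    to the labels of s.  There is one such entry if x = n, and there are two, or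
    no such x, otherwise. *)
Lemma rainbow_coboundary (l : vertex -> nat) n s :
  size s = n.+1 -> all (fun v => l v <= n) s ->
  rainbow l n.+1 s = coboundary (rainbow l n) s.
Proof.
move=> sn ln; rewrite /rainbow /coboundary.
rewrite -(big_map (map l) xpredT (fun t => perm_eq t (iota 0 n))) -faces_map.
have {sn}sr : size (map l s) = n.+1 by rewrite size_map.
have {ln} : all (leq^~ n) (map l s) by rewrite all_map.
move: (map l s) sr => r sr rn {s}.
have iotaS : perm_eq (iota 0 n.+1) (n :: iota 0 n).
  by rewrite -addn1 iotaD add0n /= perm_catC.
have [/hasP[x _ rx]|/hasPn nox] :=
    boolP (has (fun x => perm_eq r (x :: iota 0 n)) r); last first.
  rewrite (xor_faces (G := xpred0)) ?big1 //.
    apply/negbTE/negP => rS; have rnS := perm_trans rS iotaS.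
    by have := nox n; rewrite (perm_mem rnS) mem_head rnS => /(_ isT).
  move=> y t yt; apply/negbTE/negP => tn.
  have ry : perm_eq r (y :: iota 0 n).
    by apply: perm_trans (_ : perm_eq _ (y :: t)) _; rewrite ?perm_cons // perm_sym.
  by have := nox y; rewrite (perm_mem ry) mem_head ry => /(_ isT).
have xn : x <= n by apply: (allP rn); rewrite (perm_mem rx) mem_head.
rewrite (xor_faces (G := pred1 x)); last first.
  move=> y t yt; have := perm_trans yt rx => {}yt.
  apply/idP/eqP => [tn|yx]; last by move: yt; rewrite yx perm_cons.
  apply: (@perm_cons_inj _ _ _ (iota 0 n)).
  by apply: perm_trans yt; rewrite perm_cons perm_sym.
rewrite xor_count (permP rx) /= eqxx oddD /= count_uniq_mem ?iota_uniq //.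
rewrite oddb mem_iota /= add0n ltn_neqAle xn andbT negbK.
apply/idP/eqP => [rS|xEn].
  apply: (@perm_cons_inj _ _ _ (iota 0 n)).
  by apply: perm_trans (perm_trans rS iotaS); rewrite perm_sym.
by rewrite (perm_trans rx) // xEn perm_sym.
Qed.

(** The label of a sign vector b is the distance from the end of b of its last
    true entry, and [size b] if there is none.  Counting from the end makes the
    label insensitive to a leading true, which is what the induction on the
    dimension needs on the face where the first coordinate is N. *)
Definition last_true (b : seq bool) : nat := find id (rev b).

Lemma nth_last_true b i : i < size b -> last_true b = i -> nth false b (size b - i.+1).
Proof.
move=> ib bi; have hb : has id (rev b) by rewrite has_find size_rev -/(last_true b) bi.
by rewrite -nth_rev // -bi; have := nth_find false hb.
Qed.

Lemma last_true_le b i : nth false b i -> last_true b <= size b - i.+1.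
Proof.
move=> bi; have ib : i < size b by rewrite ltnNge; apply: contraL bi => /(nth_default _)->.
rewrite leqNgt; apply/negP => /(before_find false).
rewrite nth_rev //; last by rewrite ltn_subrL /= (leq_ltn_trans _ ib).
by rewrite -subSn // subSS subKn ?bi // ltnW.
Qed.

(** The boundary condition of the Poincare-Miranda theorem, for the signs of the
    components of a vector field at the grid points. *)
Definition sign_pattern N n (b : vertex -> seq bool) : Prop :=
  forall v, (size v == n) && all (leq^~ N) v ->
  size (b v) = n /\ forall i, i < n ->
  (nth 0 v i = 0 -> nth false (b v) i = false) /\
  (nth 0 v i = N -> nth false (b v) i = true).

(** Sperner's lemma for the cube.  By Stokes' formula the parity of the rainbow
    simplices equals that of the facets on the boundary that carry all labels but
    the largest.  In dimension n + 1, a face where coordinate i vanishes misses the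
    label n - i, and a face where coordinate i > 0 equals N carries only labels at
    most n - i; so the face where the first coordinate equals N contributes alone,
    and there the induction hypothesis applies. *)
Lemma odd_rainbow N n b : sign_pattern N n b ->
  \xor_(s <- grid N n) rainbow (last_true \o b) n.+1 s = true.
Proof.
elim: n b => [|n IHn] b bN.
  have [/size0nil b0 _] := bN [::] isT.
  by rewrite big_seq1 /rainbow /= /last_true b0.
rewrite (@eq_big_seq _ _ _ _ _ _ (coboundary (rainbow (last_true \o b) n.+1))); last first.
  move=> s sg; apply: rainbow_coboundary; first exact: size_grid sg.
  apply/allP => v vs; have [<- _] := bN v (allP (grid_on_grid sg) v vs).
  by rewrite -(size_rev (b v)) find_size.
rewrite stokes_one_face; first last.
- move=> i c s /andP[i0 ilt] cN /andP[/allP gs /allP fs]; apply/negbTE/negP => rs.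
  have ex j : j <= n -> exists2 v, v \in s & last_true (b v) = j.
    move=> jn; have : j \in map (last_true \o b) s.
      by rewrite (perm_mem rs) mem_iota.
    by move=> /mapP[v vs ->]; exists v.
  case/orP: cN => /eqP c0.
    have [v vs lv] := ex (n - i) (leq_subr _ _).
    have [sv /(_ i ilt)[b0 _]] := bN v (gs v vs).
    have := nth_last_true _ lv; rewrite sv ltnS leq_subr subSS subKn // => /(_ isT).
    by rewrite b0 // (eqP (fs v vs)).
  have [v vs lv] := ex n (leqnn _).
  have [sv /(_ i ilt)[_ bN']] := bN v (gs v vs).
  have := last_true_le (bN' _); rewrite (eqP (fs v vs)) lv sv subSS => /(_ c0).
  by rewrite leqNgt; move/negP; apply; rewrite ltn_subrL i0 (leq_trans i0).
- move=> s /andP[/allP gs /allP fs]; apply/negbTE/negP => rs.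
  have : n \in map (last_true \o b) s by rewrite (perm_mem rs) mem_iota add0n leqnn.
  move=> /mapP[v vs /esym/= lv].
  have [sv /(_ 0 isT)[b0 _]] := bN v (gs v vs).
  have := nth_last_true _ lv; rewrite sv ltnSn subnn => /(_ isT).
  by rewrite b0 // (eqP (fs v vs)).
have tailE v : (size v == n) && all (leq^~ N) v ->
    b (N :: v) = true :: behead (b (N :: v)).
  move=> vg; have [|sb /(_ 0 isT)[_ bt]] := bN (N :: v); first by rewrite /= leqnn eqSS.
  by case: (b (N :: v)) sb (bt erefl) => //= -[].
rewrite -[RHS](IHn (fun v => behead (b (N :: v)))); last first.
  move=> v vg; have [|sb bP] := bN (N :: v); first by rewrite /= leqnn eqSS.
  split; first by rewrite size_behead sb.
  by move=> i ilt; have := bP i.+1 ilt; rewrite nth_behead.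
apply: eq_big_seq => s sg; rewrite /rainbow -map_comp; congr perm_eq.
apply/eq_in_map => v vs /=; rewrite tailE; last exact: allP (grid_on_grid sg) v vs.
rewrite /last_true /= rev_cons -cats1 find_cat /=.
case: ifP => // hb; rewrite addn0; apply/esym/hasNfind.
by rewrite hb.
Qed.

(** A rainbow simplex contains a vertex with all signs negative and, for each i, a
    vertex whose last nonnegative sign is at i. *)
Theorem sign_change_cell N n b : sign_pattern N n b ->
  exists w : nat -> nat, forall i, i < n -> forall c : bool,
  exists2 v, (size v == n) && all (leq^~ N) v &
    nth false (b v) i = c /\ forall j, j < n -> w j <= nth 0 v j <= (w j).+1.
Proof.
move=> bN; have := odd_rainbow bN.
have [/hasP[s sg rs] _|/hasPn nors] :=
    boolP (has (rainbow (last_true \o b) n.+1) (grid N n)); last first.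
  by rewrite big_xor0 // => s /nors/negbTE.
have [w wP] := grid_cube sg; exists (nth 0 w) => i ilt c.
have [j jn jP] : exists2 j, j <= n & forall v, v \in s -> last_true (b v) = j ->
    nth false (b v) i = c.
  case: c.
    exists (n - i.+1); first exact: leq_subr.
    move=> v vs lv; have [sv _] := bN v (allP (grid_on_grid sg) v vs).
    have := nth_last_true _ lv; rewrite sv -subSn // subSS subKn; last exact: ltnW.
    by apply; exact: leq_subr.
  exists n => // v vs lv; apply/negbTE/negP => /last_true_le.
  have [-> _] := bN v (allP (grid_on_grid sg) v vs).
  by rewrite lv leqNgt ltn_subrL (leq_trans _ ilt).
have : j \in map (last_true \o b) s by rewrite (perm_mem rs) mem_iota.
move=> /mapP[v vs /esym lv]; exists v; first exact: allP (grid_on_grid sg) v vs.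
by split; [exact: jP | move=> k kn; exact: wP].
Qed.

End Sperner.

Local Open Scope classical_set_scope.
Local Open Scope ring_scope.

(** * Norms and the Poincare-Miranda theorem *)

Section Norms.
Context {R : realType} {n : nat}.
Implicit Types x y u v : 'rV[R]_n.

Lemma coord_le_norm x i : `|x 0 i| <= `|x|.
Proof.
rewrite [leRHS]/Num.norm /= mx_normrE; apply/bigmax_geP; right => /=.
by exists (0, i).
Qed.

Lemma norm_le_coord x e : 0 <= e -> (forall i, `|x 0 i| <= e) -> `|x| <= e.
Proof.
move=> e0 xe; rewrite [leLHS]/Num.norm /= mx_normrE.
apply/bigmax_leP; split => //= -[i j] _.
by rewrite ord1.
Qed.

Lemma dotDl x y u : dot (x + y) u = dot x u + dot y u.
Proof. by rewrite -big_split; apply: eq_bigr => i _; rewrite mxE mulrDl. Qed.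

Lemma dotC x y : dot x y = dot y x.
Proof. by apply: eq_bigr => i _; rewrite mulrC. Qed.

Lemma dotDr x y u : dot u (x + y) = dot u x + dot u y.
Proof. by rewrite dotC dotDl !(dotC u). Qed.

Lemma dotZl a x u : dot (a *: x) u = a * dot x u.
Proof. by rewrite mulr_sumr; apply: eq_bigr => i _; rewrite mxE mulrA. Qed.

Lemma dotZr a x u : dot u (a *: x) = a * dot u x.
Proof. by rewrite dotC dotZl dotC. Qed.

Lemma dotNl x u : dot (- x) u = - dot x u.
Proof. by rewrite -scaleN1r dotZl mulN1r. Qed.

Lemma dotNr x u : dot u (- x) = - dot u x.
Proof. by rewrite dotC dotNl dotC. Qed.

Lemma dotBl x y u : dot (x - y) u = dot x u - dot y u.
Proof. by rewrite dotDl dotNl. Qed.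

Lemma dot0r x : dot x 0 = 0.
Proof. by rewrite -(scale0r x) dotZr mul0r. Qed.

Lemma ler_norm_dot x y : `|dot x y| <= n%:R * (`|x| * `|y|).
Proof.
apply: le_trans (ler_norm_sum _ _ _) _.
have -> : n%:R * (`|x| * `|y|) = \sum_(i < n) (`|x| * `|y|).
  by rewrite sumr_const card_ord mulr_natl.
by apply: ler_sum => i _; rewrite normrM ler_pM // coord_le_norm.
Qed.

Lemma sqr_norm_le_dot x : `|x| ^+ 2 <= dot x x.
Proof.
have dge0 : 0 <= dot x x by apply: sumr_ge0 => i _; rewrite -expr2 sqr_ge0.
rewrite -[leRHS]sqr_sqrtr // lerXn2r ?nnegrE ?sqrtr_ge0 //.
apply: norm_le_coord => [|i]; first exact: sqrtr_ge0.
rewrite -sqrtr_sqr ler_wsqrtr // /dot (bigD1 i) //= -expr2 lerDl.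
by apply: sumr_ge0 => j _; rewrite -expr2 sqr_ge0.
Qed.

Lemma norm_le_enorm x : `|x| <= enorm x.
Proof.
rewrite -(ger0_norm (normr_ge0 x)) -sqrtr_sqr.
exact/ler_wsqrtr/sqr_norm_le_dot.
Qed.

Lemma dot_continuous (T : topologicalType) (g h : T -> 'rV[R]_n) :
  continuous g -> continuous h -> continuous (fun t => dot (g t) (h t)).
Proof.
move=> cg ch t; apply: cvg_big => //=; first exact: add_continuous.
move=> i _; apply: cvgM.
  apply: (continuous_cvg _ (h := fun x : 'rV[R]_n => x 0 i)); last exact: cg.
  exact: coord_continuous.
apply: (continuous_cvg _ (h := fun x : 'rV[R]_n => x 0 i)); last exact: ch.
exact: coord_continuous.
Qed.

Lemma compact_closed_ball (r : R) : compact [set x : 'rV[R]_n | `|x| <= r].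
Proof.
apply: bounded_closed_compact.
  exists r; split; first exact: num_real.
  by move=> s rs x /= xr; exact: le_trans xr (ltW rs).
apply: (@preimage_closed _ _ (fun x : 'rV[R]_n => `|x|) [set y | y <= r]) => //.
  by move=> x _; exact: norm_continuous.
Qed.

(** Uniform continuity up to the boundary of the ball: only the base point x is
    confined to it. *)
Lemma heine_cantor_ball (h : 'rV[R]_n -> 'rV[R]_n) (r e : R) :
  continuous h -> 0 < e ->
  exists2 d, 0 < d & forall x u, `|x| <= r -> `|u| < d -> `|h (x + u) - h x| < e.
Proof.
move=> ch e0.
have /compact_near_coveringP/(_ _ (0 : R)^'+
  (fun d x => forall u : 'rV[R]_n, `|u| < d -> `|h (x + u) - h x| < e)) := @compact_closed_ball r.
case=> [x _|d /= d0 dP].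
  have e2 : 0 < e / 2 by rewrite divr_gt0.
  have [d /= d0 dP] : exists2 d, 0 < d & forall y, `|x - y| < d -> `|h x - h y| < e / 2.
    have /cvgr_dist_lt/(_ _ e2) := ch x.
    by move=> /nbhs_ballP[d /= d0 dP]; exists d => // y xy; apply: dP; rewrite -ball_normE.
  have d2 : 0 < d / 2 by rewrite divr_gt0.
  exists (ball x (d / 2), [set t | 0 < t < d / 2]) => /=.
    split; first exact: nbhsx_ballx.
    by near=> t; apply/andP; split; near: t; [exact: nbhs_right_gt | exact: nbhs_right_lt].
  move=> [y t] /= [xy /andP[_ td]] u ut.
  move: xy; rewrite -ball_normE /= => xy.
  rewrite -(subrK (h x) (h (y + u))) -addrA [e]splitr (le_lt_trans (ler_normD _ _)) // ltrD //.
    rewrite distrC dP // opprD addrA (le_lt_trans (ler_normB _ _)) // [d]splitr ltrD //.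
    exact: lt_trans ut td.
  by rewrite dP // (lt_trans xy) // gtr_pMr // invf_lt1 // ltr1n.
exists (d / 2); first by rewrite divr_gt0.
move=> x u xr ud; apply: (dP (d / 2)) => //.
- by rewrite /= sub0r normrN gtr0_norm ?divr_gt0 // gtr_pMr // invf_lt1 // ltr1n.
- by rewrite divr_gt0.
Unshelve. all: by end_near.
Qed.

Lemma ball_min (h : 'rV[R]_n -> 'rV[R]_n) (r : R) : 0 <= r -> continuous h ->
  (forall x, `|x| <= r -> h x != 0) ->
  exists2 c, 0 < c & forall x, `|x| <= r -> c <= `|h x|.
Proof.
move=> r0 ch h0.
have cn : continuous (fun x => `|h x|).
  by move=> x; apply: cvg_norm (ch x).
have [||c cr cmin] := @EVT_min_rV R n (fun x => `|h x|) [set x | `|x| <= r] _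
  (@compact_closed_ball r).
- by exists 0; rewrite /= normr0.
- exact: continuous_subspaceT.
exists `|h c|; first by rewrite normr_gt0 h0 //; move: cr; rewrite inE.
by move=> x xr; apply: cmin; rewrite inE.
Qed.

End Norms.

(** The cube [-1, 1]^n is the unit ball of the sup norm, which is the norm of
    'rV[R]_n.  If h had no zero then |h| would be bounded below on the cube by some c > 0.  On
    a grid fine enough for h to vary by less than c inside a cell, the cell where
    every coordinate changes sign contradicts this bound at any of its vertices. *)
Theorem poincare_miranda (R : realType) (n : nat) (h : 'rV[R]_n -> 'rV[R]_n) :
  continuous h ->
  (forall (y : 'rV[R]_n) i, `|y| <= 1 -> y 0 i = -1 -> h y 0 i < 0) ->
  (forall (y : 'rV[R]_n) i, `|y| <= 1 -> y 0 i = 1 -> 0 <= h y 0 i) ->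
  exists2 y, `|y| <= 1 & h y = 0.
Proof.
move=> ch hm hp; apply: contrapT => no.
have h0 y : `|y| <= 1 -> h y != 0 by move=> y1; apply/eqP => hy; apply: no; exists y.
have n0 : (0 < n)%N.
  rewrite lt0n; apply/eqP => n0; have := h0 0; rewrite normr0 ler01 => /(_ isT)/eqP; apply.
  by apply/rowP => i; have := ltn_ord i; rewrite {2}n0.
have [c c0 cP] := ball_min ler01 ch h0.
have [d d0 dP] := heine_cantor_ball 1 ch c0.
have [N N0 Nd] : exists2 N : nat, (0 < N)%N & 2 / N%:R < d.
  exists (Num.truncn (2 / d)).+1 => //; rewrite ltr_pdivrMr // mulrC -ltr_pdivrMr //.
  by rewrite truncnS_gt.
have N0R : 0 < N%:R :> R by rewrite ltr0n.
pose P (v : seq nat) : 'rV[R]_n := \row_i (2 * (nth 0 v i)%:R / N%:R - 1).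
pose b v := [tuple 0 <= h (P v) 0 i | i < n].
have nthb v (i : 'I_n) : nth false (b v) i = (0 <= h (P v) 0 i) by rewrite nth_mktuple.
have Pcube v : (size v == n) && all (leq^~ N) v -> `|P v| <= 1.
  move=> /andP[/eqP sv /allP vN]; apply: norm_le_coord => // i; rewrite mxE.
  have : (nth 0 v i <= N)%N by apply: vN; rewrite mem_nth // sv.
  rewrite -(ler_nat R) => iN; rewrite ler_norml.
  have i0 : 0 <= (nth 0 v i)%:R / N%:R :> R by rewrite divr_ge0.
  have i1 : (nth 0 v i)%:R / N%:R <= 1 :> R by rewrite ler_pdivrMr // mul1r.
  by rewrite -mulrA; lra.
have [|w wP] := @sign_change_cell N n b.
  move=> v vg; split; first by rewrite size_tuple.
  move=> i0 ilt; rewrite -[i0]/(nat_of_ord (Ordinal ilt)) nthb; split => vi.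
    apply/negbTE; rewrite -ltNge; apply: hm; first exact: Pcube.
    by rewrite mxE vi mulr0 mul0r sub0r.
  apply: hp; first exact: Pcube.
  by rewrite mxE vi mulfK ?gt_eqF // [2]/(1 + 1) addrK.
have [v vg [_ vw]] := wP 0%N n0 true.
have close u : (forall j, (j < n)%N -> (w j <= nth 0 u j <= (w j).+1)%N) ->
    `|P u - P v| < d.
  move=> uw; apply: le_lt_trans Nd; apply: norm_le_coord => [|j]; first by rewrite divr_ge0.
  rewrite !mxE opprD addrACA opprK addNr addr0 -mulrBl -mulrBr -mulrA normrM.
  rewrite ger0_norm // ler_wpM2l // normrM normfV (ger0_norm (ler0n _ N)).
  rewrite ler_pdivrMr // mulVf ?gt_eqF // ler_norml.
  have /andP[] := uw j (ltn_ord j); have /andP[] := vw j (ltn_ord j).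
  rewrite -!(ler_nat R) -!natr1 => a1 a2 a3 a4.
  by apply/andP; split; lra.
have [i hi] : exists i, c <= `|h (P v) 0 i|.
  apply: contrapT => /forallNP nc.
  have : `|h (P v)| < c.
    have [->|hn0] := eqVneq `|h (P v)| 0; first by [].
    have [[j i] /= e] := mx_norm_neq0 hn0.
    rewrite (ord1 j) in e.
    by rewrite [`|h (P v)|]e ltNge; apply/negP/nc.
  by rewrite ltNge cP // Pcube.
have [u ug [ub uw]] := wP i (ltn_ord i) (h (P v) 0 i < 0).
have /= := dP (P v) (P u - P v) (Pcube _ vg) (close u uw).
rewrite [P v + _]addrC subrK; apply/negP; rewrite -leNgt.
apply: le_trans (coord_le_norm _ i); rewrite mxE [X in _ + X]mxE.
move: ub; rewrite nthb; have [hv|hv] := ltP (h (P v) 0 i) 0.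
  move=> hu; rewrite (ltr0_norm hv) in hi.
  by rewrite ger0_norm; lra.
move=> /negbT; rewrite -ltNge => hu; rewrite (ger0_norm hv) in hi.
by rewrite ler0_norm; lra.
Qed.

(** * Gradient descent for a noncritical slope *)

Section Descent.
Context {R : realType} {n : nat}.
Implicit Types (f : 'rV[R]_n -> R) (g : 'rV[R]_n -> 'rV[R]_n) (q x u : 'rV[R]_n).

(** The descent uses one step size for all base points, hence needs a remainder that
    is uniform in x.  This form of differentiability, with the gradient as a separate
    argument, passes at once to translates of f and to its sums with affine functions. *)
Definition unif_diff f g := forall e : R, 0 < e ->
  exists2 d, 0 < d & forall x u, `|u| <= d ->
    `|f (x + u) - f x - dot (g x) u| <= e * `|u|.

Definition tilt f q x := f x - dot q x.

Lemma tilt_diff f q q' x e m : `|q - q'| <= e -> `|x| <= m ->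
  tilt f q x <= tilt f q' x + n%:R * (e * m).
Proof.
move=> qe xm; have h := ler_norm_dot (q' - q) x.
have h2 : n%:R * (`|q' - q| * `|x|) <= n%:R * (e * m).
  by rewrite ler_wpM2l // ler_pM // distrC.
have := le_trans (ler_norm _) (le_trans h h2).
by rewrite dotBl /tilt; lra.
Qed.

(** The intended decrease of [tilt f q] in one step: at most th, and at most half
    of what remains above the level a, so that a is never undershot. *)
Definition descent_length f q a th x := Num.min th (Num.max 0 (tilt f q x - a) / 2).

(** A step of gradient descent for [tilt f q], whose gradient at x is
    [g x - q].  The parameter s, between 0 and 1, slows the step down. *)
Definition descent f g q a th s x :=
  x - (s * descent_length f q a th x / dot (g x - q) (g x - q)) *: (g x - q).

(** As the gradient is at least c in norm, the first order error [c / 2 * |u|] of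
    the step u is at most half of the intended decrease t. *)
Lemma descentP f g q a th c d s x (t := s * descent_length f q a th x) :
  0 < c -> c <= `|g x - q| ->
  (forall u, `|u| <= d -> `|f (x + u) - f x - dot (g x) u| <= c / 2 * `|u|) ->
  0 <= th -> th <= c * d -> 0 <= s <= 1 ->
  [/\ 0 <= t, `|descent f g q a th s x - x| * `|g x - q| <= t,
      tilt f q (descent f g q a th s x) <= tilt f q x - t / 2 &
      tilt f q x - 3 / 2 * t <= tilt f q (descent f g q a th s x)].
Proof.
move=> c0 cw fd th0 thd /andP[s0 s1].
have l0 : 0 <= descent_length f q a th x.
  by rewrite /descent_length le_min th0 divr_ge0 // le_max lexx.
have t0 : 0 <= t by rewrite mulr_ge0.
have tth : t <= th.
  by rewrite (le_trans _ (_ : descent_length f q a th x <= _)) ?ler_piMl // ge_min lexx.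
rewrite /descent -/t; set w := g x - q in cw *; set u := - ((t / dot w w) *: w).
have w0 : 0 < `|w| by exact: lt_le_trans cw.
have ww : 0 < dot w w by rewrite (lt_le_trans _ (sqr_norm_le_dot w)) // exprn_gt0.
have uw : `|u| * `|w| <= t.
  rewrite normrN normrZ ger0_norm; last by rewrite divr_ge0 // ltW.
  rewrite -mulrA -expr2 -mulrA ler_piMr // ler_pdivrMl // mulr1.
  exact: sqr_norm_le_dot.
have uc : c * `|u| <= t by rewrite (le_trans _ uw) // mulrC ler_wpM2l.
have ud : `|u| <= d by rewrite -(ler_pM2l c0) (le_trans uc) // (le_trans tth).
have du : dot w u = - t.
  by rewrite dotNr dotZr divfK // gt_eqF.
have := fd u ud; rewrite ler_norml => /andP[].
have -> : dot (g x) u = - t + dot q u by rewrite -du -dotDl subrK.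
rewrite /tilt dotDr -/u => h1 h2.
have -> : x + u - x = u by rewrite addrAC subrr add0r.
by split => //; lra.
Qed.

Lemma tilt_continuous f q : continuous f -> continuous (tilt f q).
Proof.
move=> cf x; apply: (cvgB (cf x)).
apply: (@dot_continuous _ _ _ (fun=> q) id); first exact: cst_continuous.
by move=> y; exact: cvg_id.
Qed.

Lemma descent_continuous f g q a th (T : topologicalType) (phi : T -> R)
    (h : T -> 'rV[R]_n) :
  continuous f -> continuous g -> (forall x, g x != q) ->
  continuous phi -> continuous h ->
  continuous (fun y => descent f g q a th (phi y) (h y)).
Proof.
move=> cf cg gq cphi ch y.
have cgh : continuous (fun z => g (h z) - q).
  move=> z; apply: cvgB; last exact: cvg_cst.
  by apply: (continuous_cvg _ (h := g)); [exact: cg | exact: ch].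
apply: cvgB; first exact: ch.
apply: cvgZ; last exact: cgh.
apply: cvgM.
  apply: cvgM; first exact: cphi.
  apply: (@continuous_min _ _ (fun=> th) (fun z => Num.max 0 (tilt f q (h z) - a) / 2)).
    exact: cvg_cst.
  apply: cvgM; last exact: cvg_cst.
  apply: (@continuous_max _ _ (fun=> 0) (fun z => tilt f q (h z) - a)).
    exact: cvg_cst.
  apply: cvgB; last exact: cvg_cst.
  by apply: (continuous_cvg _ (h := tilt f q)); [exact: tilt_continuous | exact: ch].
apply: cvgV; last by exact: (dot_continuous cgh cgh).
rewrite gt_eqF // (lt_le_trans _ (sqr_norm_le_dot _)) // exprn_gt0 //.
by rewrite normr_gt0 subr_eq0.
Qed.

(** S 1 pushes the sublevel b of [tilt f q] into the sublevel [a + e], moving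
    nothing below the level a, and S s for s between 0 and 1 interpolates between
    the identity and S 1.  The second part of the fourth clause bounds the
    displacement beyond norm rho in terms of the drop alone, by a constant that
    does not depend on q; this is what keeps repeated applications inside a fixed
    ball. *)
Definition pushdown f q (a b e rho c0 : R) (S : R -> 'rV[R]_n -> 'rV[R]_n) : Prop :=
  [/\ forall (T : topologicalType) (phi : T -> R) (h : T -> 'rV[R]_n),
        continuous phi -> continuous h -> continuous (fun y => S (phi y) (h y)),
      forall x, S 0 x = x,
      forall s x, tilt f q x <= a -> S s x = x,
      forall s x, 0 <= s <= 1 -> tilt f q (S s x) <= tilt f q x /\
        Num.max `|S s x| rho <=
          Num.max `|x| rho + 2 / c0 * Num.max 0 (tilt f q x - a) &
      forall x, tilt f q x <= b -> tilt f q (S 1 x) <= a + e].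

(** If q is at positive distance c from the values of the gradient then [tilt f q]
    has no critical points, and enough steps of gradient descent go from level b
    to level [a + e].  The lower bound c may be tiny, but a point of norm at least
    rho moves by at most 2 / c0 times its drop, while a point of norm less than rho
    has norm at most rho + 1 after one step.  So the quantity
    max(|x|, rho + 1) + 2 / c0 * tilt f q x does not increase. *)
Lemma pushdown_exists f g q c a b e rho c0 :
  continuous f -> continuous g -> unif_diff f g ->
  0 < c -> (forall x, c <= `|g x - q|) ->
  0 < c0 -> (forall x, rho <= `|x| -> c0 <= `|g x - q|) -> 0 < e ->
  exists S, pushdown f q a b e (rho + 1) c0 S.
Proof.
move=> cf cg fg c_gt0 cP c0_gt0 c0P e0.
have [d d0 dP] := fg _ (divr_gt0 c_gt0 (ltr0Sn R 1)).
pose th := c * Num.min d 1.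
have m0 : 0 < Num.min d 1 by rewrite lt_min d0 ltr01.
have th0 : 0 < th by rewrite mulr_gt0.
have thd : th <= c * d by rewrite ler_pM2l // ge_min lexx.
have th1 : th <= c by rewrite -[leRHS]mulr1 ler_pM2l // ge_min lexx orbT.
pose D := descent f g q a th.
have DP s x := @descentP f g q a th c d s x c_gt0 (cP x) (dP x) (ltW th0) thd.
have D0 x : D 0 x = x by rewrite /D /descent !mul0r scale0r subr0.
have Dfix s x : tilt f q x <= a -> D s x = x.
  move=> xa; rewrite /D /descent /descent_length max_l ?subr_le0 // mul0r.
  by rewrite min_r ?(ltW th0) // mulr0 mul0r scale0r subr0.
have Dlow s x : 0 <= s <= 1 -> a <= tilt f q x -> a <= tilt f q (D s x).
  move=> s01 ax; have [t0 _ _] := DP s x s01; apply: le_trans.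
  move: t0; have /andP[s0 s1] := s01.
  have l2 : descent_length f q a th x <= (tilt f q x - a) / 2.
    by rewrite /descent_length ge_min max_r ?subr_ge0 // lexx orbT.
  have l0 : 0 <= descent_length f q a th x.
    by rewrite /descent_length le_min ltW //= divr_ge0 // le_max lexx.
  have : s * descent_length f q a th x <= descent_length f q a th x by rewrite ler_piMl.
  by lra.
have Dle s x : 0 <= s <= 1 -> tilt f q (D s x) <= tilt f q x.
  by move=> s01; have [t0 _ + _] := DP s x s01; move: t0; rewrite -/(D s x); lra.
have Dpot s x : 0 <= s <= 1 -> Num.max `|D s x| (rho + 1) + 2 / c0 * tilt f q (D s x)
    <= Num.max `|x| (rho + 1) + 2 / c0 * tilt f q x.
  move=> s01; have [t0 tw td _] := DP s x s01; rewrite -/(D s x) in tw td.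
  set t := s * _ in t0 tw td.
  have xD : `|D s x| <= `|x| + `|D s x - x|.
    by rewrite -{1}(subrK x (D s x)) addrC ler_normD.
  have c20 : 0 < 2 / c0 by rewrite divr_gt0.
  have [xr|rx] := ltP `|x| rho.
    have D1 : `|D s x - x| <= 1.
      have tc : t <= c.
        rewrite (le_trans _ th1) // /t; have /andP[s0 s1] := s01.
        rewrite (le_trans _ (_ : descent_length f q a th x <= _)) ?ge_min ?lexx //.
        by rewrite ler_piMl // le_min ltW //= divr_ge0 // le_max lexx.
      rewrite -(ler_pM2r c_gt0) mul1r (le_trans _ tc) // (le_trans _ tw) //.
      by rewrite ler_wpM2l.
    rewrite [leLHS]addrC [leRHS]addrC lerD ?ler_pM2l ?Dle //.
    rewrite !max_r //; lra.
  have Dt : `|D s x - x| <= 2 / c0 * (tilt f q x - tilt f q (D s x)).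
    rewrite mulrAC ler_pdivlMr // (le_trans (_ : _ <= t)) //; last by lra.
    by rewrite (le_trans _ tw) // ler_wpM2l // c0P.
  rewrite mulrBr in Dt; rewrite -lerBrDr ge_max; apply/andP; split.
    have : `|x| <= Num.max `|x| (rho + 1) by rewrite le_max lexx.
    by lra.
  have : rho + 1 <= Num.max `|x| (rho + 1) by rewrite le_max lexx orbT.
  have : 2 / c0 * tilt f q (D s x) <= 2 / c0 * tilt f q x by rewrite ler_pM2l // Dle.
  by lra.
pose kap := Num.min th (e / 2) / 2.
have kap0 : 0 < kap by rewrite divr_gt0 // lt_min th0 divr_gt0.
pose N := (Num.truncn ((b - a) / kap)).+1.
exists (fun s => iter N (D s)); split.
- move=> T phi h cphi ch; elim: N => //= k IHk.
  apply: descent_continuous => // x; rewrite -subr_eq0 -normr_gt0.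
  exact: lt_le_trans c_gt0 (cP x).
- by move=> x; elim: N => //= k ->.
- by move=> s x xa; elim: N => //= k ->; rewrite Dfix.
- move=> s x s01.
  have le_it k : tilt f q (iter k (D s) x) <= tilt f q x.
    by elim: k => //= k; apply: le_trans; exact: Dle.
  split => //; have [xa|ax] := leP (tilt f q x) a.
    have -> : iter N (D s) x = x by elim: N => //= k ->; rewrite Dfix.
    by rewrite [Num.max 0 _]max_l ?subr_le0 // mulr0 addr0.
  have low : a <= tilt f q (iter N (D s) x).
    by elim: N => [|k IHk]; [exact: ltW | exact: Dlow].
  have pot : Num.max `|iter N (D s) x| (rho + 1) + 2 / c0 * tilt f q (iter N (D s) x)
    <= Num.max `|x| (rho + 1) + 2 / c0 * tilt f q x.
    by elim: N {low} => //= k; apply: le_trans; exact: Dpot.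
  have c20 : 0 < 2 / c0 by rewrite divr_gt0.
  rewrite [Num.max 0 _]max_r ?subr_ge0 ?(ltW ax) // mulrBr.
  move: low; rewrite -(ler_pM2l c20); move: pot; lra.
- move=> x xb; have s01 : 0 <= (1 : R) <= 1 by rewrite ler01 lexx.
  have H k : tilt f q (iter k (D 1) x) <= Num.max (a + e) (b - k%:R * kap).
    elim: k => [|k IHk]; first by rewrite mul0r subr0 le_max xb orbT.
    rewrite iterS; set z := iter k _ x in IHk *.
    have [za|az] := leP (tilt f q z) (a + e).
      by rewrite le_max (le_trans (Dle _ _ s01)).
    rewrite le_max; apply/orP; right.
    have [_ _ + _] := DP 1 z s01; rewrite mul1r -/(D 1 z).
    have : Num.min th (e / 2) <= descent_length f q a th z.
      rewrite /descent_length le_min ge_min lexx /= ge_min; apply/orP; right.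
      rewrite ler_pM2r ?invr_gt0 // le_max; apply/orP; right; lra.
    move: IHk; rewrite le_max leNgt az /= -[k.+1%:R]natr1 /kap; lra.
  apply: le_trans (H N) _; rewrite ge_max lexx /=.
  have : (b - a) / kap < N%:R by exact: truncnS_gt.
  by rewrite ltr_pdivrMr //; lra.
Qed.

End Descent.

(** * Covering the parameter cube *)

Lemma card_lattice_interval (R : realType) (N M : nat) (t : R) : (0 < N)%N ->
  (#|[pred k : 'I_M | `|t - (k%:R / N%:R - 1)|%R < 2 / N%:R :> R]%R| <= 4)%N.
Proof.
move=> N0; set A := [pred k : 'I_M | _].
have N0R : 0 < N%:R :> R by rewrite ltr0n.
have [/existsP[k0 Ak0]|/existsPn noA] := boolP [exists k, k \in A]; last first.
  by rewrite eq_card0 // => k; apply/negbTE/noA.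
case: (arg_minnP (fun k : 'I_M => nat_of_ord k) Ak0) => k1 Ak1 k1min.
rewrite cardE -(size_map val) -(size_iota k1 4); apply: uniq_leq_size.
  by rewrite (map_inj_uniq val_inj) enum_uniq.
move=> _ /mapP[k + ->]; rewrite mem_enum mem_iota => Ak; rewrite k1min //=.
rewrite -(ltr_nat R) natrD.
have : (k%:R - k1%:R) / N%:R < 4 / N%:R :> R.
  move: Ak Ak1; rewrite /A !inE /= !ltr_norml => /andP[h1 h2] /andP[h3 h4].
  by rewrite mulrBl; lra.
by rewrite ltr_pM2r ?invr_gt0 //; lra.
Qed.

(** The overlap L depends on the dimension only, not on the mesh eta; the
    error bookkeeping of the sweep rests on this. *)
Lemma lattice_cover (R : realType) (n : nat) :
  exists L : nat, forall eta : R, 0 < eta ->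
  exists s : R, exists zs : seq 'rV[R]_n,
  [/\ 0 < s <= eta, (forall z, z \in zs -> `|z| <= 1),
      (forall y, `|y| <= 1 -> exists2 z, z \in zs & `|y - z| <= s) &
      (forall y, (count (fun z => (`|y - z| < 2 * s)%R) zs <= L)%N)].
Proof.
exists (4 ^ n)%N => eta eta0.
pose N := (Num.truncn eta^-1).+1.
have N0R : 0 < N%:R :> R by rewrite ltr0n.
pose pt (v : {ffun 'I_n -> 'I_(2 * N).+1}) : 'rV[R]_n :=
  \row_i ((v i)%:R / N%:R - 1).
exists N%:R^-1, (map pt (enum {: {ffun 'I_n -> 'I_(2 * N).+1}})); split.
- rewrite invr_gt0 N0R /= -[leRHS]invrK lef_pV2 ?posrE ?invr_gt0 //.
  exact/ltW/truncnS_gt.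
- move=> _ /mapP[v _ ->]; apply: norm_le_coord => // i; rewrite mxE.
  have : (v i)%:R <= (2 * N)%:R :> R by rewrite ler_nat -ltnS.
  rewrite natrM => vi.
  have v0 : 0 <= (v i)%:R / N%:R :> R by rewrite divr_ge0.
  have v2 : (v i)%:R / N%:R <= 2 :> R by rewrite ler_pdivrMr.
  by rewrite ler_norml; apply/andP; split; lra.
- move=> y y1.
  have yi i : 0 <= N%:R * (y 0 i + 1) <= 2 * N%:R.
    have := le_trans (coord_le_norm y i) y1; rewrite ler_norml => /andP[h1 h2].
    rewrite mulr_ge0 ?(ltW N0R) //=; last by lra.
    by rewrite mulrC ler_pM2r //; lra.
  pose v := [ffun i => inord (Num.truncn (N%:R * (y 0 i + 1))) : 'I_(2 * N).+1].
  exists (pt v); first by rewrite map_f // mem_enum.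
  apply: norm_le_coord => [|i]; first by rewrite invr_ge0 ltW.
  have /andP[y0 y2] := yi i; have /andP[t1 t2] := truncn_itv y0.
  rewrite !mxE ffunE inordK; last first.
    by rewrite ltnS -(ler_nat R) natrM (le_trans t1).
  set k := Num.truncn _ in t1 t2 *.
  have -> : y 0 i - (k%:R / N%:R - 1) = (N%:R * (y 0 i + 1) - k%:R) / N%:R.
    by rewrite mulrBl mulrAC mulfV ?gt_eqF // mul1r opprB addrA.
  rewrite normrM [`|N%:R^-1|]gtr0_norm ?invr_gt0 // ler_piMl ?invr_ge0 ?(ltW N0R) //.
  by rewrite -natr1 in t2; rewrite ler_norml; apply/andP; split; lra.
- move=> y; rewrite count_map.
  have -> : count (preim pt (fun z => (`|y - z| < 2 * N%:R^-1)%R))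
      (enum {: {ffun 'I_n -> 'I_(2 * N).+1}}) = #|[pred v | `|y - pt v| < 2 / N%:R]%R|.
    by rewrite cardE [in RHS]/enum_mem size_filter enumT; apply: eq_count.
  apply: (@leq_trans #|family (fun i : 'I_n => [pred k : 'I_(2 * N).+1 |
      `|y 0 i - (k%:R / N%:R - 1)| < 2 / N%:R]%R)|).
    apply: subset_leq_card; apply/fintype.subsetP => v; rewrite inE => yv.
    apply/familyP => i; rewrite inE; apply: le_lt_trans yv.
    by rewrite (le_trans _ (coord_le_norm _ i)) // !mxE.
  rewrite card_family -[n in (_ <= 4 ^ n)%N]card_ord -prod_nat_const.
  rewrite foldrE big_map big_enum /=; apply: leq_prod => i _.
  exact: card_lattice_interval.
Qed.

Section Sweep.
Context {R : realType} {n : nat}.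
Variables (f : 'rV[R]_n -> R) (g : 'rV[R]_n -> 'rV[R]_n).
Hypotheses (cf : continuous f) (cg : continuous g) (fg : unif_diff f g).
Hypotheses (f0 : f 0 = 0) (g0 : g 0 = 0).

Definition cutoff (s : R) (z y : 'rV[R]_n) : R :=
  Num.max 0 (Num.min 1 (2 - `|y - z| / s)).

Lemma cutoff_itv s z y : 0 <= cutoff s z y <= 1.
Proof. by rewrite /cutoff le_max lexx /= ge_max ler01 ge_min lexx. Qed.

Lemma cutoff1 s z y : 0 < s -> `|y - z| <= s -> cutoff s z y = 1.
Proof.
move=> s0 yz; have : `|y - z| / s <= 1 by rewrite ler_pdivrMr // mul1r.
by move=> h; rewrite /cutoff min_l ?max_r //; lra.
Qed.

Lemma cutoff0 s z y : 0 < s -> 2 * s <= `|y - z| -> cutoff s z y = 0.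
Proof.
move=> s0 yz; have : 2 <= `|y - z| / s by rewrite ler_pdivlMr.
by move=> h; rewrite /cutoff max_l // ge_min; apply/orP; right; lra.
Qed.

Lemma cutoff_continuous (T : topologicalType) s z (h : T -> 'rV[R]_n) :
  continuous h -> continuous (fun t => cutoff s z (h t)).
Proof.
move=> ch t.
apply: (@continuous_max _ _ (fun=> 0) (fun t => Num.min 1 (2 - `|h t - z| / s))).
  exact: cvg_cst.
apply: (@continuous_min _ _ (fun=> 1) (fun t => 2 - `|h t - z| / s)).
  exact: cvg_cst.
apply: cvgB; first exact: cvg_cst.
apply: cvgM; last exact: cvg_cst.
apply: cvg_norm; apply: cvgB; [exact: ch | exact: cvg_cst].
Qed.

(** Each deformation S z acts only over the support of [phi z], meant to be a
    small cell around z, so that only few of them matter over a given y. *)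
Fixpoint sweep (phi : 'rV[R]_n -> 'rV[R]_n -> R)
    (S : 'rV[R]_n -> R -> 'rV[R]_n -> 'rV[R]_n) (d : R) (zs : seq 'rV[R]_n)
    (y : 'rV[R]_n) : 'rV[R]_n :=
  if zs is z :: zs' then S z (phi z y) (sweep phi S d zs' y) else d *: y.

(** Suppose that the slopes at positive distance from the values of the gradient g,
    a distance bounded below near infinity independently of the slope, are dense near
    0 = g 0. For y in the cube [-1, 1]^n consider the slope k *: y. Since
    f = o(|x|), the map y |-> d *: y satisfies tilt f (k *: y) (d *: y) <= - be on
    the boundary of the cube. Sweeping over a fine lattice of points z, each with an
    omitted slope q z close to k *: z, deforms it, relative to the boundary, to a
    continuous map h with tilt f (k *: y) (h y) < 0 on the whole cube. But h equals
    y |-> d *: y on the boundary, so it has a zero y, where tilt f (k *: y) (h y) =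
    tilt f (k *: y) 0 = 0.

    Passing from k *: y to q z and back costs at most 2 * E at each of the at most L
    steps that move the point over y, because all points stay in the ball of radius M. As M depends
    on L but not on the mesh, the mesh can be chosen afterwards so that the total
    cost 2 * L * E is less than be / 4. *)
Theorem no_dense_regular_slopes (k rho c0 : R) : 0 < k -> 0 < c0 ->
  ~ (forall p : 'rV[R]_n, `|p| <= k -> forall e, 0 < e -> exists q : 'rV[R]_n,
    [/\ `|q - p| <= e, (exists2 c, 0 < c & forall x, c <= `|g x - q|) &
        forall x, rho <= `|x| -> c0 <= `|g x - q|]).
Proof.
move=> k0 c00 dense.
have [d d0 dP] := fg (divr_gt0 k0 (ltr0Sn R 1)).
pose be := k * d / 2.
have be0 : 0 < be by rewrite divr_gt0 // mulr_gt0.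
have start (y : 'rV[R]_n) : `|y| <= 1 ->
    tilt f (k *: y) (d *: y) <= be * `|y| - 2 * be * `|y| ^+ 2.
  move=> y1; have yd : `|d *: y| <= d by rewrite normrZ gtr0_norm // ler_piMr // ltW.
  have := dP 0 _ yd; rewrite add0r f0 g0 subr0 dotC dot0r subr0 => fy.
  have := le_trans (ler_norm _) fy; rewrite normrZ gtr0_norm // => {}fy.
  rewrite /tilt dotZl dotZr.
  have : k * d * `|y| ^+ 2 <= k * d * dot y y.
    by rewrite ler_pM2l ?mulr_gt0 // sqr_norm_le_dot.
  by rewrite /be; lra.
have [L LP] := @lattice_cover R n.
pose a := - (be / 2); pose b := 2 * be.
(* A single step drops from level b to level a at most, so it adds at most D to the
   norm of a point. *)
pose M0 := Num.max d (rho + 1).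
pose D := 2 / c0 * (b - a).
have D0 : 0 < D by rewrite mulr_gt0 ?divr_gt0 // /a /b; lra.
pose M := M0 + L%:R * D.
have M0_gt0 : 0 < M0 by rewrite lt_max d0.
have Mpos : 0 < M by rewrite ltr_pwDl // mulr_ge0 // ltW.
pose e := be / (8 * L.+1%:R * n.+1%:R * M).
have e0 : 0 < e by rewrite divr_gt0 // !mulr_gt0.
pose E := n%:R * (e * M).
have E0 : 0 <= E by rewrite mulr_ge0 // mulr_ge0 // ltW.
have EL : E * L.+1%:R * 8 <= be.
  have -> : E * L.+1%:R * 8 = be * (n%:R / n.+1%:R).
    by rewrite /E /e; field; rewrite !nat1r !pnatr_eq0 (gt_eqF Mpos).
  by rewrite ger_pMr // ler_pdivrMr // mul1r ler_nat.
have EL' : E * L%:R * 8 <= be - E * 8 by move: EL; rewrite -natr1; lra.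
have ELk m : (m <= L)%N -> E * m%:R * 8 <= be - E * 8.
  move=> mL; apply: le_trans EL'; rewrite ler_pM2r // ler_wpM2l // ler_nat //.
have eta0 : 0 < e / (4 * k) by rewrite divr_gt0 // mulr_gt0.
have [s [zs [/andP[s0 seta] zs1 zscov zscount]]] := LP _ eta0.
have ks : k * (2 * s) <= e / 2.
  move: seta; rewrite ler_pdivlMr ?mulr_gt0 //; lra.
have /choice[qS qSP] : forall z : 'rV[R]_n,
    exists qS : 'rV[R]_n * (R -> 'rV[R]_n -> 'rV[R]_n),
    `|z| <= 1 -> `|qS.1 - k *: z| <= e / 2 /\
      pushdown f qS.1 a b (be / 8) (rho + 1) c0 qS.2.
  move=> z; have [z1|] := boolP (`|z| <= 1); last by exists (0, fun=> id).
  have kz : `|k *: z| <= k by rewrite normrZ gtr0_norm // ler_piMr // ltW.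
  have [q [qz [c c_gt0 cP] c0P]] := dense _ kz _ (divr_gt0 e0 (ltr0Sn R 1)).
  have [S SP] := pushdown_exists a b cf cg fg c_gt0 cP c00 c0P
    (divr_gt0 be0 (ltr0Sn R 7)).
  by exists (q, S).
pose S z := (qS z).2; pose q z := (qS z).1.
have SP z : `|z| <= 1 -> pushdown f (q z) a b (be / 8) (rho + 1) c0 (S z).
  by move=> /qSP[].
have qP z y : `|z| <= 1 -> `|y - z| < 2 * s -> `|q z - k *: y| <= e.
  move=> /qSP[qz _] yz; rewrite -(subrK (k *: z) (q z)) -addrA.
  rewrite (le_trans (ler_normD _ _)) //.
  rewrite -scalerBr normrZ gtr0_norm // (distrC z).
  have : k * `|y - z| <= k * (2 * s) by rewrite ler_pM2l // ltW.
  by move: qz; rewrite /q; lra.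
pose h ts := sweep (cutoff s) S d ts.
pose act y := count (fun z : 'rV[R]_n => `|y - z| < 2 * s).
have hcont ts : (forall z, z \in ts -> `|z| <= 1) -> continuous (h ts).
  elim: ts => [|z ts IHts] ts1.
    exact: scaler_continuous.
  have [Sc _ _ _ _] := SP z (ts1 z (mem_head _ _)).
  apply: Sc; first by apply: (@cutoff_continuous _ s z id) => y; exact: cvg_id.
  by apply: IHts => t tts; apply: ts1; rewrite inE tts orbT.
(* Over the boundary of the cube all points already lie below the level a. *)
have hbdry y ts : (forall z, z \in ts -> `|z| <= 1) -> `|y| = 1 -> h ts y = d *: y.
  move=> + y1; elim: ts => [//|z ts IHts] ts1; rewrite /h /= -/(h ts y).
  have -> : h ts y = d *: y.
    by apply: IHts => t tts; apply: ts1; rewrite inE tts orbT.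
  have z1 := ts1 z (mem_head _ _).
  have [_ S0 Sfix _ _] := SP z z1.
  have [yz|yz] := leP (2 * s) `|y - z|; first by rewrite cutoff0.
  apply: Sfix; have yd : `|d *: y| <= M.
    rewrite normrZ gtr0_norm // y1 mulr1.
    have : d <= M0 by rewrite /M0 le_max lexx.
    have : 0 <= L%:R * D by rewrite mulr_ge0 // ltW.
    by rewrite /M; lra.
  apply: le_trans (tilt_diff f (qP z y z1 yz) yd) _.
  rewrite -/E; have := start y; rewrite y1 lexx expr1n => /(_ isT).
  have := ELk 0%N (leq0n _); rewrite /a; lra.
(* The third bound persists once some z with y in its core, where the cutoff is 1,
   has been treated. *)
have hinv y ts :
    `|y| <= 1 -> (forall z, z \in ts -> `|z| <= 1) -> (act y ts <= L)%N ->
   [/\ Num.max `|h ts y| (rho + 1) <= M0 + (act y ts)%:R * D,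
       tilt f (k *: y) (h ts y) <= be + (act y ts)%:R * (2 * E) &
       (exists2 z, z \in ts & `|y - z| <= s) ->
         tilt f (k *: y) (h ts y) <= a + be / 8 + (act y ts)%:R * (2 * E)].
  move=> y1; elim: ts => [_ _|z ts IHts ts1 actL].
    rewrite /= !mul0r !addr0; split; last by case.
      by rewrite /M0 ge_max !le_max lexx orbT andbT normrZ gtr0_norm // ler_piMr // ltW.
    have := start y y1; have := sqr_ge0 `|y|.
    have : be * `|y| <= be by rewrite ler_piMr // ltW.
    have : 0 <= be * `|y| ^+ 2 by rewrite mulr_ge0 ?sqr_ge0 // ltW.
    by lra.
  have z1 := ts1 z (mem_head _ _).
  have {}ts1 t : t \in ts -> `|t| <= 1 by move=> tts; apply: ts1; rewrite inE tts orbT.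
  have actLts : (act y ts <= L)%N by apply: leq_trans actL; rewrite /= leq_addl.
  have {IHts} [hM hF hdone] := IHts ts1 actLts.
  rewrite /act /h /= -/(act y ts) -/(h ts y); set x := h ts y in hM hF hdone *.
  have [Scont S0 Sfix Sdec Sdone] := SP z z1.
  have [yz|yz] := leP (2 * s) `|y - z|.
    rewrite cutoff0 // S0 add0n; split => // -[t]; rewrite inE => /orP[/eqP->|tts] yt.
      by have := le_trans yz yt; lra.
    by apply: hdone; exists t.
  rewrite /= in actL.
  move: actL; rewrite /act /= yz add1n -/(act y ts) => actL.
  rewrite -natr1 !mulrDl !mul1r.
  set m := act y ts in hM hF hdone actL *.
  have xM : `|x| <= M0 + m%:R * D by apply: le_trans hM; rewrite le_max lexx.
  have MD r : (r <= L)%N -> M0 + r%:R * D <= M.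
    by move=> rL; rewrite /M lerD2l ler_pM2r // ler_nat.
  have qyz := qP z y z1 yz.
  have t1 := tilt_diff f qyz (le_trans xM (MD _ (ltnW actL))).
  have ELm := ELk _ (ltnW actL).
  have tb : tilt f (q z) x <= b.
    by move: t1; rewrite -/E /b; lra.
  have [Sd Sn] := Sdec (cutoff s z y) x (cutoff_itv _ _ _).
  set x' := S z _ x in Sd Sn *.
  have hM' : Num.max `|x'| (rho + 1) <= M0 + (m%:R * D + D).
    apply: le_trans Sn _; rewrite addrA; apply: lerD => //.
    rewrite ler_pM2l ?divr_gt0 // ge_max; apply/andP; split.
      by rewrite /a /b; lra.
    by rewrite lerD2r.
  have x'M : `|x'| <= M.
    apply: le_trans (_ : _ <= M0 + m.+1%:R * D) (MD _ actL).
    apply: le_trans (_ : Num.max `|x'| (rho + 1) <= _); first by rewrite le_max lexx.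
    by rewrite -natr1 mulrDl mul1r.
  have qyz' : `|k *: y - q z| <= e by rewrite distrC.
  have t2 := tilt_diff f qyz' x'M.
  rewrite -/E in t1 t2.
  split => //; first by lra.
  move=> [t]; rewrite inE => /orP[/eqP->|tts] yt.
    have := Sdone x tb; have -> : S z 1 x = x' by rewrite /x' (cutoff1 s0 yt).
    have : 0 <= m%:R * (2 * E) by rewrite mulr_ge0 // mulr_ge0.
    by lra.
  have /hdone : exists2 z, z \in ts & `|y - z| <= s by exists t.
  by lra.
have [||y y1 hy] := poincare_miranda (hcont zs zs1).
- move=> y i y1 yi.
  have yn : `|y| = 1.
    by apply/eqP; rewrite eq_le y1 (le_trans _ (coord_le_norm y i)) // yi normrN1.
  by rewrite hbdry // mxE yi mulrN1 oppr_lt0.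
- move=> y i y1 yi.
  have yn : `|y| = 1.
    by apply/eqP; rewrite eq_le y1 (le_trans _ (coord_le_norm y i)) // yi normr1.
  by rewrite hbdry // mxE yi mulr1 ltW.
have [_ _ /(_ (zscov y y1))] := hinv y zs y1 zs1 (zscount y).
rewrite hy /tilt f0 dot0r subr0.
have := ELk _ (zscount y); rewrite -/(act y zs) /a; lra.
Qed.

End Sweep.

(** * Gradients with a limit at infinity *)

Section C1.
Context {R : realType} {n : nat}.
Implicit Types (f : 'rV[R]_n -> R) (x u p : 'rV[R]_n).

Lemma derive_grad f x u : differentiable f x -> 'D_u f x = dot (grad f x) u.
Proof.
move=> df; rewrite (deriveE _ df) {1}(row_sum_delta u) linear_sum.
apply: eq_bigr => i _; rewrite linearZ mxE (deriveE _ df) mulrC; congr (_ * _).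
Qed.

Lemma mean_value_grad f x u : (forall x, differentiable f x) ->
  exists t, 0 <= t <= 1 /\ f (x + u) - f x = dot (grad f (x + t *: u)) u.
Proof.
move=> df; pose l t := f (x + t *: u).
have lE t : (fun h : R => h^-1 *: ((l \o shift t) (h *: 1) - l t)) =
    (fun h => h^-1 *: ((f \o shift (x + t *: u)) (h *: u) - f (x + t *: u))).
  apply/funext => h; rewrite /l /= /shift /=; congr (_ *: (f _ - _)).
  by rewrite [h *: 1]mulr1 scalerDl addrCA.
have dl t : is_derive t (1 : R) l (dot (grad f (x + t *: u)) u).
  have dfu : derivable f (x + t *: u) u by exact: diff_derivable.
  split; first by rewrite /derivable lE.
  by rewrite /derive lE -(derive_grad u (df _)).
have cl : {within `[0, 1], continuous l}.
  apply: continuous_subspaceT => s; apply: differentiable_continuous.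
  by apply/derivable1_diffP; have [] := dl s.
have [t tI] := MVT_segment ler01 (fun s _ => dl s) cl.
rewrite subr0 mulr1 /l scale1r scale0r addr0 => ->.
by exists t; split => //; move: tI; rewrite in_itv.
Qed.

Lemma affine_of_const_grad f p : (forall x, differentiable f x) ->
  (forall x, grad f x = p) -> is_affine f.
Proof.
move=> df gp; exists p, (f 0) => x.
have [t [_]] := mean_value_grad 0 x df; rewrite add0r gp => /eqP.
by rewrite subr_eq => /eqP.
Qed.

Lemma grad_near_infinity f p : grad f x @[x --> enorm_pinfty R n] --> p ->
  forall e, 0 < e -> exists M, forall x, M < `|x| -> `|grad f x - p| < e.
Proof.
move=> fp e e0; have [M MP] := @cvgr_dist_lt _ _ _ _ _ _ _ fp e e0.
by exists M => x Mx; rewrite distrC; apply: MP; exact: lt_le_trans Mx (norm_le_enorm x).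
Qed.

(** The gradient is uniformly continuous: by compactness on a ball, and outside it
    because its values are close to p. *)
Lemma unif_diff_grad f p : is_C1 f -> grad f x @[x --> enorm_pinfty R n] --> p ->
  unif_diff f (grad f).
Proof.
move=> [df cg] fp e e0.
pose e' := e / n.+1%:R; have e'0 : 0 < e' by rewrite divr_gt0.
have [M MP] := grad_near_infinity fp (divr_gt0 e'0 (ltr0Sn R 1)).
have [d d0 dP] := heine_cantor_ball (M + 1) cg e'0.
have uc x u : `|u| < Num.min d 1 -> `|grad f (x + u) - grad f x| <= e'.
  rewrite lt_min => /andP[ud u1].
  have [xM|Mx] := leP `|x| (M + 1); first exact/ltW/dP.
  have xu : M < `|x + u|.
    have : `|x| <= `|x + u| + `|u| by rewrite -{1}(addrK u x) ler_normB.
    by lra.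
  rewrite -(subrK p (grad f (x + u))) -addrA (le_trans (ler_normD _ _)) //.
  have h1 := MP _ xu; have h2 : `|p - grad f x| < e' / 2 by rewrite distrC MP //; lra.
  by lra.
have m0 : 0 < Num.min d 1 by rewrite lt_min d0 ltr01.
exists (Num.min d 1 / 2); first by rewrite divr_gt0.
move=> x u ud; have [t [/andP[t0 t1] ->]] := mean_value_grad x u df.
rewrite -dotBl (le_trans (ler_norm_dot _ _)) //.
have tu : `|t *: u| < Num.min d 1.
  have : `|t *: u| <= `|u| by rewrite normrZ ger0_norm // ler_piMl.
  by lra.
have := uc x _ tu => h.
apply: (@le_trans _ _ (n%:R * (e' * `|u|))).
  by rewrite ler_wpM2l // ler_wpM2r.
rewrite mulrA ler_wpM2r // /e' mulrCA ger_pMr // ler_pdivrMr // mul1r.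
by rewrite ler_nat.
Qed.

(** Otherwise a ball around [grad f x0] contains no interior point of the gradient
    range, so the slopes outside this range are dense in it.  Each of them is at
    positive distance from the range: near infinity because the ball stays away
    from p, elsewhere by compactness.  Now move x0 and [grad f x0] to the origin. *)
Lemma regular_grad_in_closure f p x0 : is_C1 f ->
  grad f x @[x --> enorm_pinfty R n] --> p -> grad f x0 != p ->
  closure (interior (range (grad f))) (grad f x0).
Proof.
move=> fC1 fp x0p; have [df cg] := fC1; have fg := unif_diff_grad fC1 fp.
apply: contrapT; set p0 := grad f x0 in x0p *.
rewrite /closure /= => /existsNP[B] /not_implyP[/nbhs_ballP[r /= r0 rB] noB].
have {noB rB} nointer p' : `|p' - p0| < r -> ~ interior (range (grad f)) p'.
  move=> p'r intp'; apply: noB; exists p'; split => //; apply: rB.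
  by rewrite -ball_normE /= distrC.
pose eta := `|p - p0| / 3.
have eta0 : 0 < eta by rewrite divr_gt0 // normr_gt0 subr_eq0 eq_sym.
have [M MP] := grad_near_infinity fp eta0.
pose k := Num.min r eta / 2.
have min0 : 0 < Num.min r eta by rewrite lt_min r0.
have k0 : 0 < k by rewrite divr_gt0.
have kr : k < r.
  have : Num.min r eta <= r by rewrite ge_min lexx.
  by rewrite /k; lra.
have keta : k + k <= eta by rewrite -splitr ge_min lexx orbT.
pose g x := grad f (x + x0) - p0.
pose ft x := f (x + x0) - f x0 - dot p0 x.
have cshift : continuous (fun x : 'rV[R]_n => x + x0).
  by move=> x; apply: (cvgD (@cvg_id _ _) (cvg_cst _)).
have cgx : continuous (fun x => grad f (x + x0)).
  by move=> x; exact: (continuous_comp (cshift x) (cg (x + x0))).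
have cgt : continuous g by move=> x; apply: (cvgB (cgx x) (cvg_cst _)).
have cft : continuous ft.
  have cfx : continuous (fun x => f (x + x0) - f x0).
    move=> x.
    have cfx : f (y + x0) @[y --> x] --> f (x + x0).
      exact: (continuous_comp (cshift x) (differentiable_continuous (df (x + x0)))).
    by apply: (cvgB cfx (cvg_cst _)).
  move=> x; apply: (@tilt_continuous _ _ _ p0 cfx).
apply: (@no_dense_regular_slopes R n ft g cft cgt _ _ _ k (M + `|x0| + 1) eta k0 eta0).
- move=> e e0; have [d d0 dP] := fg e e0; exists d => // x u ud.
  have := dP (x + x0) u ud; congr (`|_| <= _).
  rewrite /ft /g dotBl dotDr (addrAC x u x0); ring.
- by rewrite /ft add0r dot0r subrr subr0.
- by rewrite /g add0r subrr.
move=> q pq e e0.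
have far q' x : `|q'| <= eta -> M + `|x0| + 1 <= `|x| -> eta <= `|g x - q'|.
  move=> q'e Mx; have xM : M < `|x + x0|.
    have : `|x| <= `|x + x0| + `|x0| by rewrite -{1}(addrK x0 x) ler_normB.
    by lra.
  have := MP _ xM.
  have : `|p - p0| <= `|g x - q'| + `|q'| + `|grad f (x + x0) - p|.
    have -> : p - p0 = (g x - q') + q' - (grad f (x + x0) - p).
      by apply/rowP => i; rewrite /g !mxE; ring.
    by rewrite (le_trans (ler_normB _ _)) // lerD2r ler_normD.
  by move: q'e; rewrite /eta; lra.
have e'0 : 0 < Num.min e k by rewrite lt_min e0.
have : exists2 q', `|q' - (p0 + q)| < Num.min e k & ~ range (grad f) q'.
  apply: contrapT => nex; apply: (nointer (p0 + q)).
    by rewrite [p0 + q]addrC addrK (le_lt_trans pq).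
  apply/nbhs_ballP; exists (Num.min e k) => // q' qq'; apply: contrapT => nq'.
  by apply: nex; exists q' => //; rewrite distrC; move: qq'; rewrite -ball_normE.
move=> [q' q'q nq']; exists (q' - p0).
have qe : `|q' - p0 - q| < Num.min e k by rewrite -addrA -opprD.
have /andP[qe1 qk] : (`|q' - p0 - q| < e) && (`|q' - p0 - q| < k) by rewrite -lt_min.
have qeta : `|q' - p0| <= eta.
  by rewrite -(subrK q (q' - p0)) (le_trans (ler_normD _ _)) //; lra.
split; [exact: ltW| |by move=> x; exact: far].
have [M0|M0] := ltP (M + `|x0| + 1) 0.
  by exists eta => // x; apply: far => //; apply: le_trans (ltW M0) _.
have [||c c0 cP] := @ball_min R n (fun x => g x - (q' - p0)) (M + `|x0| + 1) M0.
- by move=> x; apply: (cvgB (cgt x) (cvg_cst _)).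
- move=> x _; apply/eqP => /eqP; rewrite subr_eq0 => /eqP /addIr gq.
  by apply: nq'; exists (x + x0).
exists (Num.min c eta); first by rewrite lt_min c0.
move=> x; have [xM|Mx] := leP `|x| (M + `|x0| + 1).
  by rewrite ge_min cP.
by rewrite ge_min far ?orbT // ltW.
Qed.

(** The limit p itself: since f is not affine, the gradient takes values other than
    p, and by the intermediate value theorem it takes such values arbitrarily
    close to p. *)
Lemma limit_grad_in_closure f p x0 : is_C1 f -> ~ is_affine f ->
  grad f x @[x --> enorm_pinfty R n] --> p -> grad f x0 = p ->
  closure (interior (range (grad f))) (grad f x0).
Proof.
move=> fC1 fnaff fp x0p; have [df cg] := fC1.
have [x1 x1p] : exists x1, grad f x1 != p.
  apply: contrapT => /forallNP h; apply: fnaff; apply: (affine_of_const_grad (p := p) df).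
  by move=> x; apply/eqP/negP => /negP; exact: h.
move=> B /nbhs_ballP[r /= r0 rB].
pose phi t := `|grad f (x0 + t *: (x1 - x0)) - p|.
have cphi : continuous phi.
  move=> t; apply: cvg_norm; apply: cvgB; last exact: cvg_cst.
  apply: (continuous_cvg _ (h := grad f)); first exact: cg.
  apply: cvgD; first exact: cvg_cst.
  exact: scalel_continuous.
have phi0 : phi 0 = 0 by rewrite /phi scale0r addr0 x0p subrr normr0.
have phi1 : 0 < phi 1 by rewrite /phi scale1r (addrC x0) subrK normr_gt0 subr_eq0.
pose v := Num.min (r / 2) (phi 1).
have v0 : 0 < v by rewrite lt_min phi1 divr_gt0.
have [||t _ tv] := @IVT R phi 0 1 v ler01.
- exact: continuous_subspaceT.
- rewrite phi0 min_l ?(ltW phi1) // max_r ?(ltW phi1) // ltW //=.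
  by rewrite ge_min lexx orbT.
set x := x0 + t *: (x1 - x0).
have xp : grad f x != p by rewrite -subr_eq0 -normr_gt0 [ltRHS]tv.
have xr : ball p r (grad f x).
  rewrite -ball_normE /= distrC [ltLHS]tv gt_min; apply/orP; left.
  by rewrite gtr_pMr // invf_lt1 // ltr1n.
have nb : nbhs (grad f x) (ball p r).
  by apply: open_nbhs_nbhs; split => //; exact: ball_open.
have [q [qi qB]] := regular_grad_in_closure fC1 fp xp nb.
by exists q; split => //; apply: rB; rewrite x0p.
Qed.

End C1.

Theorem corollary1p3 (R : realType) (n : nat) (f : 'rV[R]_n -> R)
    (hn : (1 <= n)%N) (hC1 : is_C1 f) (hnaff : ~ is_affine f)
    (hlim : exists p : 'rV[R]_n, grad f x @[x --> enorm_pinfty R n] --> p) :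
  closure (range (grad f)) = closure (interior (range (grad f))).
Proof.
have [p fp] := hlim.
apply/seteqP; split; last by apply: closureS; exact: interior_subset.
move=> y yG; apply: closed_closure; move: y yG.
apply: closureS => _ [x _ <-].
have [xp|xp] := eqVneq (grad f x) p.
  exact: limit_grad_in_closure fp xp.
exact: regular_grad_in_closure fp xp.
Qed.
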